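(* The logic AMLFI1 is strongly complete: for every $\Gamma\subseteq\mathcal{L}_{AM}$ and $\alpha\in\mathcal{L}_{AM}$, $\Gamma\vDash_{AMLFI1}\alpha$ implies $\Gamma\vdash_{AMLFI1}\alpha$.
   Context: **Language.** $P$ is a countable set of propositional variables and $N$ a finite set of agents. The formulas of $\mathcal{L}_{AM}$ and the action models are defined by simultaneous recursion. Formulas: $\alpha ::= p \mid \neg\alpha \mid \bullet\alpha \mid (\alpha\land\alpha) \mid K_i\alpha \mid [U,e]\alpha$, with $p\in P$, $i\in N$, $U$ an action model and $e$ an action of $U$. An action model is $U=\langle E,\{\sim_i\}_{i\in N},\mathrm{pre}\rangle$ with $E$ a finite non-empty set of actions, each $\sim_i$ an equivalence relation on $E$, and $\mathrm{pre}:E\to\mathcal{L}_{AM}$ (preconditions). **Abbreviations.** $\circ\alpha:=\neg\bullet\alpha$; $\alpha\lor\beta:=\neg(\neg\alpha\land\neg\beta)$; $\sim\!\alpha:=\neg\alpha\land\circ\alpha$; $\alpha\to\beta:=\ \sim\!\alpha\lor\beta$; $\alpha\leftrightarrow\beta:=(\alpha\to\beta)\land(\beta\to\alpha)$; $\alpha\equiv\beta:=(\alpha\leftrightarrow\beta)\land(\neg\alpha\leftrightarrow\neg\beta)$; $\hat K_i\alpha:=\neg K_i\neg\alpha$. **Proof system AMLFI1** (all schemata range over formulas of $\mathcal{L}_{AM}$, $i\in N$, $p\in P$). LFI1 part: A1 $\alpha\to(\beta\to\alpha)$; A2 $(\alpha\to(\beta\to\gamma))\to((\alpha\to\beta)\to(\alpha\to\gamma))$;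 A3 $\alpha\to(\beta\to(\alpha\land\beta))$; A4 $(\alpha\land\beta)\to\alpha$; A5 $(\alpha\land\beta)\to\beta$; A6 $\alpha\to(\alpha\lor\beta)$; A7 $\beta\to(\alpha\lor\beta)$; A8 $(\alpha\to\gamma)\to((\beta\to\gamma)\to((\alpha\lor\beta)\to\gamma))$; A9 $\alpha\lor(\alpha\to\beta)$; A10 $\alpha\lor\neg\alpha$; A11 $\circ\alpha\to(\alpha\to(\neg\alpha\to\beta))$; A12 $\bullet\alpha\to(\alpha\land\neg\alpha)$; A13 $\neg\neg\alpha\leftrightarrow\alpha$; A14 $\neg(\alpha\lor\beta)\leftrightarrow(\neg\alpha\land\neg\beta)$; A15 $\neg(\alpha\land\beta)\leftrightarrow(\neg\alpha\lor\neg\beta)$; A16 $\neg(\alpha\to\beta)\leftrightarrow(\alpha\land\neg\beta)$; rule MP: $\alpha,\alpha\to\beta\Rightarrow\beta$. Modal (S5LFI1) part: K $K_i(\alpha\to\beta)\to(K_i\alpha\to K_i\beta)$; K$_1$ $K_i(\alpha\to\beta)\to(\hat K_i\alpha\to\hat K_i\beta)$; K$_2$ $\hat K_i(\alpha\lor\beta)\to(\hat K_i\alpha\lor\hat K_i\beta)$; K$_3$ $(\hat K_i\alpha\to K_i\beta)\to K_i(\alpha\to\beta)$; T $K_i\alpha\to\alpha$; 4 $K_i\alpha\to K_iK_i\alpha$; 5 $\hat K_i\alpha\to K_i\hat K_i\alpha$; T$'$ $\alpha\to\hat K_i\alpha$; 4$'$ $\hat K_i\hat K_i\alpha\to\hat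 K_i\alpha$; 5$'$ $\hat K_iK_i\alpha\to K_i\alpha$; rule Nec: $\alpha\Rightarrow K_i\alpha$. Dynamic part: AM1 $[U,e]p\equiv(\mathrm{pre}(e)\to p)$; AM2 $[U,e]\neg\alpha\equiv(\mathrm{pre}(e)\to\neg[U,e]\alpha)$; AM3 $[U,e]\bullet\alpha\equiv(\mathrm{pre}(e)\to\bullet[U,e]\alpha)$; AM4 $[U,e](\alpha\land\beta)\equiv([U,e]\alpha\land[U,e]\beta)$; AM5 $[U,e]K_i\alpha\equiv(\mathrm{pre}(e)\to\bigwedge_{e\sim_i f}K_i[U,f]\alpha)$; rule RE: $\theta\equiv\gamma\Rightarrow\alpha\equiv\alpha(\theta/\gamma)$, where $\alpha(\theta/\gamma)$ is $\alpha$ with occurrences of $\theta$ replaced by $\gamma$ (in $[U,e]\delta$ the replacement acts in $\delta$; the action model is left unchanged). $\Gamma\vdash_{AMLFI1}\alpha$ means there is a finite derivation of $\alpha$ from axioms and members of $\Gamma$, where MP may be applied to any formulas already obtained, while all other rules (Nec, RE) may be applied only to theorems, i.e. formulas derivable from $\emptyset$. **Semantics.** Truth values $\{0,\tfrac12,1\}$, designated values $D=\{1,\tfrac12\}$. A Kripke model is $M=\langle S,\{\sim_i\}_{i\in N},\vartheta\rangle$ with $S$ a set of states, each $\sim_i$ an equivalence relation on $S$, and for each $s\in S$ a map $\vartheta_s:P\to\{0,\tfrac12,1\}$, extended to formulas by: $\vartheta_s(\neg\alpha)=1-\vartheta_s(\alpha)$; $\vartheta_s(\bullet\alpha)=1$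 if $\vartheta_s(\alpha)=\tfrac12$ and $0$ otherwise; $\vartheta_s(\alpha\land\beta)=\min\{\vartheta_s(\alpha),\vartheta_s(\beta)\}$; $\vartheta_s(K_i\alpha)=\inf\{\vartheta_{t}(\alpha):s\sim_i t\}$ (with $\inf\emptyset=1$); $\vartheta_s([U,e]\alpha)=\vartheta'_{(s,e)}(\alpha)$ if $\vartheta_s(\mathrm{pre}(e))\in D$, and $1$ otherwise. Here $\vartheta'$ is the valuation of the updated model $M\otimes U=\langle S',\{\sim_i'\},\vartheta'\rangle$ with $S'=\{(t,f):t\in S,f\in E,\vartheta_t(\mathrm{pre}(f))\in D\}$, $(t,f)\sim'_i(u,g)$ iff $t\sim_i u$ and $f\sim_i g$, and $\vartheta'_{(t,f)}(p)=\vartheta_t(p)$ for $p\in P$. $\Gamma\vDash_{AMLFI1}\alpha$ means: for every such model and every state $s$, if $\vartheta_s(\gamma)\in D$ for all $\gamma\in\Gamma$ then $\vartheta_s(\alpha)\in D$. *)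

(* Defs.v *)
From mathcomp Require Import all_boot all_order all_algebra.
From mathcomp Require Import boolp classical_sets.

Set Implicit Arguments.
Unset Strict Implicit.
Unset Printing Implicit Defensive.

Local Open Scope classical_set_scope.

Declare Scope am_scope.
Delimit Scope am_scope with am.

(** * Language *)

(* An action model without its preconditions.  Formulas and action models are
   defined by simultaneous recursion; since the action [e] of [[U,e]a] has a
   type that depends on [U], the part of [U] that does not mention formulas is
   separated out, and [U] is stored in a formula as a frame together with a
   precondition map. *)
Record aframe (N : Type) := AFrame {
  act_type :> finType;
  arel : N -> rel act_type;
  action_gt0 : 0 < #|act_type|;
  arel_equiv : forall i, equivalence_rel (arel i) }.

Inductive fml (P N : Type) : Type :=
| Var of P
| Neg of fml P N
| Bul of fml P N
| And of fml P N & fml P N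
| K of N & fml P N
| Upd (F : aframe N) (pre : F -> fml P N) (e : F) (a : fml P N).

Record amodel (P N : Type) := AModel {
  amodel_frame :> aframe N;
  pre : amodel_frame -> fml P N }.

Definition upd P N (U : amodel P N) (e : U) (a : fml P N) : fml P N :=
  Upd (@pre P N U) e a.

Arguments Var {P N}.
Bind Scope am_scope with fml.

Section Abbreviations.
Context {P N : Type}.
Implicit Types a b : fml P N.

Definition Circ a := Neg (Bul a).
Definition Or a b := Neg (And (Neg a) (Neg b)).
Definition Sneg a := And (Neg a) (Circ a).
Definition Imp a b := Or (Sneg a) b.
Definition Iff a b := And (Imp a b) (Imp b a).
Definition Equ a b := And (Iff a b) (Iff (Neg a) (Neg b)).
Definition Kh i a := Neg (K i (Neg a)).

End Abbreviations.

Notation "¬ a" := (Neg a) (at level 75, right associativity) : am_scope.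
Notation "● a" := (Bul a) (at level 75, right associativity) : am_scope.
Notation "○ a" := (Circ a) (at level 75, right associativity) : am_scope.
Notation "a ∧ b" := (And a b) (at level 80, right associativity) : am_scope.
Notation "a ∨ b" := (Or a b) (at level 85, right associativity) : am_scope.
Notation "a ↔ b" := (Iff a b) (at level 95, no associativity) : am_scope.
Notation "a ≡ b" := (Equ a b) (at level 95, no associativity) : am_scope.
Notation "a → b" := (Imp a b) (at level 99, right associativity) : am_scope.
Notation "⟦ U , e ⟧ a" := (@upd _ _ U e a)
  (at level 75, right associativity, format "⟦ U ,  e ⟧  a") : am_scope.

(** * Proof system *)

Section ProofSystem.
Context {P : Type} {N : Type}.
Implicit Types (a b c : fml P N) (U : amodel P N) (i : N) (p : P).

(* [repl t g a] replaces every occurrence of [t] in [a] by [g]; action models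
   are left unchanged.  Equality of formulas is decided classically. *)
Fixpoint repl (t g a : fml P N) : fml P N :=
  if `[< a = t >] then g else
  match a with
  | Var p => Var p
  | Neg b => Neg (repl t g b)
  | Bul b => Bul (repl t g b)
  | And b c => And (repl t g b) (repl t g c)
  | K i b => K i (repl t g b)
  | Upd F pr e b => Upd pr e (repl t g b)
  end.

(* The language has no empty conjunction: [d] is a dummy value, never reached
   in [conj_related], where the list contains [e] itself. *)
Definition conjs (d : fml P N) (s : seq (fml P N)) : fml P N :=
  if s is a :: s' then foldl (@And P N) a s' else d.

Definition conj_related U i (e : U) a : fml P N :=
  conjs a [seq K i (upd f a) | f <- enum (arel i e)].

Local Open Scope am_scope.

Inductive axiom : fml P N -> Prop :=
| A1 a b : axiom (a → b → a)
| A2 a b c : axiom ((a → b → c) → (a → b) → (a → c))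
| A3 a b : axiom (a → b → (a ∧ b))
| A4 a b : axiom ((a ∧ b) → a)
| A5 a b : axiom ((a ∧ b) → b)
| A6 a b : axiom (a → (a ∨ b))
| A7 a b : axiom (b → (a ∨ b))
| A8 a b c : axiom ((a → c) → (b → c) → ((a ∨ b) → c))
| A9 a b : axiom (a ∨ (a → b))
| A10 a : axiom (a ∨ ¬ a)
| A11 a b : axiom (○ a → a → ¬ a → b)
| A12 a : axiom (● a → (a ∧ ¬ a))
| A13 a : axiom (¬ ¬ a ↔ a)
| A14 a b : axiom (¬ (a ∨ b) ↔ (¬ a ∧ ¬ b))
| A15 a b : axiom (¬ (a ∧ b) ↔ (¬ a ∨ ¬ b))
| A16 a b : axiom (¬ (a → b) ↔ (a ∧ ¬ b))
| AxK i a b : axiom (K i (a → b) → K i a → K i b)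
| AxK1 i a b : axiom (K i (a → b) → Kh i a → Kh i b)
| AxK2 i a b : axiom (Kh i (a ∨ b) → (Kh i a ∨ Kh i b))
| AxK3 i a b : axiom ((Kh i a → K i b) → K i (a → b))
| AxT i a : axiom (K i a → a)
| Ax4 i a : axiom (K i a → K i (K i a))
| Ax5 i a : axiom (Kh i a → K i (Kh i a))
| AxT' i a : axiom (a → Kh i a)
| Ax4' i a : axiom (Kh i (Kh i a) → Kh i a)
| Ax5' i a : axiom (Kh i (K i a) → K i a)
| AM1 U (e : U) p : axiom (⟦U, e⟧ (Var p) ≡ (pre e → Var p))
| AM2 U (e : U) a : axiom (⟦U, e⟧ (¬ a) ≡ (pre e → ¬ ⟦U, e⟧ a))
| AM3 U (e : U) a : axiom (⟦U, e⟧ (● a) ≡ (pre e → ● ⟦U, e⟧ a))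
| AM4 U (e : U) a b :
    axiom (⟦U, e⟧ (a ∧ b) ≡ (⟦U, e⟧ a ∧ ⟦U, e⟧ b))
| AM5 U (e : U) i a :
    axiom (⟦U, e⟧ (K i a) ≡ (pre e → conj_related i e a)).

Inductive derives (G : fml P N -> Prop) : fml P N -> Prop :=
| Der_hyp a : G a -> derives G a
| Der_ax a : axiom a -> derives G a
| Der_MP a b : derives G a -> derives G (a → b) -> derives G b
| Der_Nec i a : derives (fun _ => False) a -> derives G (K i a)
| Der_RE t g a :
    derives (fun _ => False) (t ≡ g) -> derives G (a ≡ repl t g a).

End ProofSystem.

(** * Semantics *)

(* The values 0, 1/2, 1; the operations are compared with the numerical ones
   through [tval] below. *)
Inductive tv := T0 | Thalf | T1.

Definition designated (v : tv) : bool := if v is T0 then false else true.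

Definition tneg (v : tv) : tv :=
  match v with T0 => T1 | Thalf => Thalf | T1 => T0 end.

Definition tbul (v : tv) : tv := if v is Thalf then T1 else T0.

Definition tmin (v w : tv) : tv :=
  match v, w with
  | T0, _ | _, T0 => T0
  | Thalf, _ | _, Thalf => Thalf
  | T1, T1 => T1
  end.

Definition tinf (A : set tv) : tv :=
  if `[< A T0 >] then T0 else if `[< A Thalf >] then Thalf else T1.

Section NumericalValues.
Import Order.TTheory GRing.Theory Num.Theory.
Local Open Scope ring_scope.

Definition tval (v : tv) : rat :=
  match v with T0 => 0 | Thalf => 2%:R^-1 | T1 => 1 end.

Lemma tval_neg v : tval (tneg v) = 1 - tval v.
Proof. by case: v; apply/eqP. Qed.

Lemma tval_min v w : tval (tmin v w) = Num.min (tval v) (tval w).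
Proof. by case: v; case: w; apply/eqP. Qed.

Lemma tinf_lb (A : set tv) v : A v -> tval (tinf A) <= tval v.
Proof.
rewrite /tinf; case: asboolP => [_ _|nA0]; first by case: v.
by case: asboolP => [_|nAh]; case: v.
Qed.

Lemma tinf_glb (A : set tv) w :
  (forall v, A v -> tval w <= tval v) -> tval w <= tval (tinf A).
Proof.
rewrite /tinf => lbw; case: asboolP => [/lbw //|_].
by case: asboolP => [/lbw //|_]; case: w {lbw}.
Qed.

End NumericalValues.

Record kmodel (P N : Type) := KModel {
  state :> Type;
  krel : N -> state -> state -> Prop;
  krel_equiv : forall i, RelationClasses.Equivalence (krel i);
  valuation : state -> P -> tv }.

Section Product.
Context {P N : Type} (M : kmodel P N) (F : aframe N).
(* [d f t] states that the precondition of [f] is designated at [t]. *)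
Variable d : F -> M -> bool.

Definition product_state : Type := {x : M * F | d x.2 x.1}.

Definition product_rel i (x y : product_state) : Prop :=
  krel i (sval x).1 (sval y).1 /\ arel i (sval x).2 (sval y).2.

Lemma product_rel_equiv i : RelationClasses.Equivalence (product_rel i).
Proof.
have [kr ks kt] := @krel_equiv P N M i.
have ae := @arel_equiv N F i.
have ar (x : F) : arel i x x by case: (ae x x x).
have as_ (x y : F) : arel i x y -> arel i y x.
  by move=> xy; have [_ /(_ xy) <-] := ae x y x.
split.
- by move=> x; split; [exact: kr|exact: ar].
- by move=> x y [? ?]; split; [exact: ks|exact: as_].
- move=> x y z [xy1 xy2] [yz1 yz2]; split; first exact: (kt _ _ _ xy1 yz1).
  by have [_ /(_ xy2) ->] := ae (sval x).2 (sval y).2 (sval z).2.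
Qed.

Definition product : kmodel P N :=
  KModel product_rel_equiv (fun x : product_state => valuation (sval x).1).

End Product.

(* The updated model depends on the values of the preconditions, so it is built
   inside the recursion. *)
Fixpoint eval P N (a : fml P N) (M : kmodel P N) (s : M) {struct a} : tv :=
  match a with
  | Var p => valuation s p
  | Neg b => tneg (eval b s)
  | Bul b => tbul (eval b s)
  | And b c => tmin (eval b s) (eval c s)
  | K i b => tinf [set v | exists2 t : M, krel i s t & eval b t = v]
  | Upd F pr e b =>
      let d := fun (f : F) (t : M) => designated (eval (pr f) t) in
      match decP (@idP (d e s)) with
      | left h => @eval P N b (product d) (exist _ (s, e) h)
      | right _ => T1
      end
  end.

Definition update P N (M : kmodel P N) (U : amodel P N) : kmodel P N :=
  product (fun (f : U) (t : M) => designated (eval (pre f) t)).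

Lemma eval_updT P N (M : kmodel P N) (U : amodel P N) (e : U) a (s : M)
    (h : designated (eval (pre e) s)) :
  eval (upd e a) s = @eval P N a (update M U) (exist _ (s, e) h).
Proof.
rewrite /upd /=; case: (decP _) => [h'|/(_ h) //].
by rewrite (bool_irrelevance h' h).
Qed.

Lemma eval_updF P N (M : kmodel P N) (U : amodel P N) (e : U) a (s : M) :
  ~~ designated (eval (pre e) s) -> eval (upd e a) s = T1.
Proof.
by move=> /negP nh; rewrite /upd /=; case: (decP _) => // h; case: nh.
Qed.

Definition entails P N (G : fml P N -> Prop) (a : fml P N) : Prop :=
  forall (M : kmodel P N) (s : M),
    (forall g, G g -> designated (eval g s)) -> designated (eval a s).

(* Main.v *)
(* Membership of [a] and of [¬ a] in a prime theory determines a truth value of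
   [a], and these values commute with the connectives and, along the usual
   canonical relation, with [K i].  Hence the canonical model verifies the truth
   lemma for formulas without updates.  The reduction axioms and RE rewrite any
   formula into such a formula without changing its value, neither in a prime
   theory nor in a Kripke model, so the truth lemma extends to all formulas. *)
Require Import Defs.
From mathcomp Require Import all_boot.
From mathcomp Require Import boolp classical_sets.

Set Implicit Arguments.
Unset Strict Implicit.
Unset Printing Implicit Defensive.

(** * Truth values through designation *)

(** Designation of a value and of its negation separates all three values, so an equality of values
    splits into two statements about designation. *)
Lemma tv_ext (v w : tv) :
  (designated v <-> designated w) ->
  (designated (tneg v) <-> designated (tneg w)) -> v = w.
Proof. by case: v; case: w => //= -[h1 h2] [h3 h4]; exfalso; auto. Qed.

Lemma designated_tmin v w : designated (tmin v w) = designated v && designated w.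
Proof. by case: v; case: w. Qed.

Lemma designated_tneg_tmin v w :
  designated (tneg (tmin v w)) = designated (tneg v) || designated (tneg w).
Proof. by case: v; case: w. Qed.

Lemma designated_tinf (A : set tv) :
  designated (tinf A) <-> forall v, A v -> designated v.
Proof.
rewrite /tinf; case: asboolP => [A0|nA0]; first by split=> // /(_ _ A0).
have dA : forall v, A v -> designated v by case.
by case: asboolP.
Qed.

Lemma designated_tneg_tinf (A : set tv) :
  designated (tneg (tinf A)) <-> exists2 v, A v & designated (tneg v).
Proof.
rewrite /tinf; case: asboolP => [A0|nA0]; first by split=> // _; exists T0.
case: asboolP => [Ah|nAh]; first by split=> // _; exists Thalf.
by split=> // -[[]].
Qed.

(** * Towers and their fixed point *)

(* The Bourbaki-Witt tower of [f] replaces the library's Zorn lemma, which does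
   not apply to sets of formulas: formulas contain finite types, hence live in a
   universe too large for [set (fml P N)]. *)
Section Tower.
Context {T : Type} (f : (T -> Prop) -> (T -> Prop)).
Implicit Types X Y Z : T -> Prop.

Definition incl X Y : Prop := forall x, X x -> Y x.

Definition union (C : (T -> Prop) -> Prop) : T -> Prop :=
  fun x => exists2 X, C X & X x.

Hypothesis incl_f : forall X, incl X (f X).

(** Unions of arbitrary families are allowed, so the empty set needs no clause; that the tower is a
    chain is proved afterwards. *)
Inductive tower : (T -> Prop) -> Prop :=
| tower_step X : tower X -> tower (f X)
| tower_union (C : (T -> Prop) -> Prop) :
    (forall X, C X -> tower X) -> tower (union C).

Lemma incl_trans X Y Z : incl X Y -> incl Y Z -> incl X Z.
Proof. by move=> XY YZ x /XY /YZ. Qed.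

Lemma incl_anti X Y : incl X Y -> incl Y X -> X = Y.
Proof. by move=> XY YX; apply/funext => x; apply/propext; split; auto. Qed.

Definition extremal X : Prop :=
  forall Y, tower Y -> incl Y X -> ~ incl X Y -> incl (f Y) X.

(** Climbing the tower cannot jump over [X]: a step from a member strictly below [X] stays inside
    [X] by extremality, and a step from [X] itself yields [f X]. *)
Lemma extremal_dichotomy X Y :
  extremal X -> tower Y -> incl Y X \/ incl (f X) Y.
Proof.
move=> eX; elim=> {Y} [Y tY [YX|fXY]|C _ IH].
- have [XY|nXY] := pselect (incl X Y); last by left; exact: eX.
  by right; rewrite (incl_anti XY YX).
- by right; exact: incl_trans fXY (@incl_f Y).
- have [[Y CY fXY]|nC] := pselect (exists2 Y, C Y & incl (f X) Y).
    by right=> x /fXY Yx; exists Y.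
  left=> x [Y CY Yx]; have [YX|fXY] := IH _ CY; first exact: YX.
  by case: nC; exists Y.
Qed.

Lemma tower_extremal X : tower X -> extremal X.
Proof.
elim=> {X} [X tX eX|C _ IH] Y tY YX nXY.
  have [YX'|//] := extremal_dichotomy eX tY.
  have [XY|nXY'] := pselect (incl X Y).
    by rewrite (incl_anti XY YX').
  exact: incl_trans (eX _ tY YX' nXY') (@incl_f X).
(* As [Y] misses part of the union, some [Z] in [C] is not inside [Y]; the dichotomy for [Z] then
   puts [Y] strictly below [Z]. *)
have [Z CZ nZY] : exists2 Z, C Z & ~ incl Z Y.
  apply: contrapT => nC; apply: nXY => x [Z CZ Zx].
  by apply: contrapT => nYx; apply: nC; exists Z => // /(_ _ Zx).
have [YZ|fZY] := extremal_dichotomy (IH _ CZ) tY.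
  by move=> x /(IH _ CZ _ tY YZ nZY) Zx; exists Z.
by case: nZY; exact: incl_trans (@incl_f Z) fZY.
Qed.

Lemma tower_total X Y : tower X -> tower Y -> incl X Y \/ incl Y X.
Proof.
move=> /tower_extremal eX tY; have [|fXY] := extremal_dichotomy eX tY.
  by right.
by left; exact: incl_trans (@incl_f X) fXY.
Qed.

(** The union of the whole tower belongs impredicatively to the tower, so [f] cannot enlarge it. *)
Lemma tower_top : tower (union tower) /\ incl (f (union tower)) (union tower).
Proof.
have tU : tower (union tower) by exact: tower_union.
by split=> // x fUx; exists (f (union tower)) => //; exact: tower_step.
Qed.

End Tower.

Section Completeness.
Context {P N : Type}.
Implicit Types (a b c t g : fml P N) (G X Y : fml P N -> Prop) (i : N).
Local Open Scope am_scope.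

Local Notation axiom := Defs.axiom.
Local Notation thm := (derives (fun _ : fml P N => False)).

(** * Derivations and their hypotheses *)

Lemma derives_weaken G X a :
  derives G a -> (forall b, G b -> X b) -> derives X a.
Proof.
move=> Ga; elim: Ga X => {G a}.
- by move=> G a Ga X GX; apply: Der_hyp; exact: GX.
- by move=> G a ? X _; exact: Der_ax.
- by move=> G a b _ IHa _ IHab X GX; apply: Der_MP (IHa _ GX) (IHab _ GX).
- by move=> G i a da _ X _; exact: Der_Nec.
- by move=> G t g a da _ X _; exact: Der_RE.
Qed.

Lemma thm_derives G a : thm a -> derives G a.
Proof. by move/derives_weaken; apply. Qed.

Lemma derives_imp_const G a b : derives G b -> derives G (a → b).
Proof. by move=> Gb; apply: Der_MP Gb (Der_ax _ (A1 _ _)). Qed.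

Lemma derives_imp_refl G a : derives G (a → a).
Proof.
apply: Der_MP (Der_ax G (A1 a a)) _.
exact: Der_MP (Der_ax G (A1 a (a → a))) (Der_ax G (A2 _ _ _)).
Qed.

(** Nec and RE act on theorems only, so their conclusions behave like axioms; only MP needs A2. *)
Lemma deduction G a b :
  derives (fun x => G x \/ x = a) b -> derives G (a → b).
Proof.
set X := (fun x => _) => Xb.
have XG x : X x -> G x \/ x = a by [].
elim: Xb XG => {X b}.
- move=> X b Xb XG; case: (XG _ Xb) => [Gb|->]; last exact: derives_imp_refl.
  exact/derives_imp_const/Der_hyp.
- by move=> X b ? _; apply/derives_imp_const/Der_ax.
- move=> X b c _ IHb _ IHbc XG; apply: Der_MP (IHb XG) _.
  exact: Der_MP (IHbc XG) (Der_ax _ (A2 _ _ _)).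
- by move=> X i b db _ _; apply/derives_imp_const/Der_Nec.
- by move=> X t g b db _ _; apply/derives_imp_const/Der_RE.
Qed.

(** Compactness along a chain: MP joins two members of [C] into the larger one. The first
    alternative covers an empty [C]. *)
Lemma derives_chain G (C : (fml P N -> Prop) -> Prop) a :
  (forall X Y, C X -> C Y -> incl X Y \/ incl Y X) ->
  derives (fun x => G x \/ union C x) a ->
  derives G a \/ exists2 X, C X & derives (fun x => G x \/ X x) a.
Proof.
move=> totC da.
set H := (fun x => _) in da.
have HG x : H x -> G x \/ exists2 X, C X & X x by [].
elim: da HG => {H a}.
- move=> H a Ha HG; case: (HG _ Ha) => [Ga|[X CX Xa]].
    by left; exact: Der_hyp.
  by right; exists X => //; apply: Der_hyp; right.
- by move=> H a ? _; left; exact: Der_ax.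
- move=> H a b _ IHa _ IHab HG.
  case: (IHa HG) (IHab HG) => [Ga|[X CX Xa]] [Gab|[Y CY Yab]].
  + by left; exact: Der_MP Ga Gab.
  + right; exists Y => //; apply: Der_MP Yab.
    by apply: derives_weaken Ga _ => x; left.
  + right; exists X => //; apply: Der_MP Xa _.
    by apply: derives_weaken Gab _ => x; left.
  + case: (totC _ _ CX CY) => [XY|YX]; [right; exists Y|right; exists X] => //.
      by apply: Der_MP Yab; apply: derives_weaken Xa _ => x [?|/XY]; [left|right].
    by apply: Der_MP Xa _; apply: derives_weaken Yab _ => x [?|/YX]; [left|right].
- by move=> H i b db _ _; left; exact: Der_Nec.
- by move=> H t g b db _ _; left; exact: Der_RE.
Qed.

(** * Prime theories and the Lindenbaum lemma *)

(** A theory may contain both [a] and [¬ a]; only triviality is excluded. *)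
Record theory := Theory {
  mem :> fml P N -> Prop;
  mem_thm : forall a, thm a -> mem a;
  mem_mp : forall a b, mem a -> mem (a → b) -> mem b;
  mem_prime : forall a b, mem (a ∨ b) -> mem a \/ mem b;
  mem_proper : exists a, ~ mem a }.

Implicit Types D E : theory.

Lemma Lindenbaum G a :
  ~ derives G a -> exists2 D : theory, (forall b, G b -> D b) & ~ D a.
Proof.
move=> nGa.
pose con X := ~ derives (fun x => G x \/ X x) a.
pose adds X b := ~ X b /\ con (fun x => X x \/ x = b).
(* [f] adds one chosen new formula that keeps [a] underivable, if there is one; a fixed point is
   therefore maximal. *)
pose f X := if pselect (exists b, adds X b) is left h
            then fun x => X x \/ x = sval (cid h) else X.
have incl_f X : incl X (f X) by rewrite /f; case: pselect => h x Xx //; left.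
have tower_con X : tower f X -> con X.
  elim=> {X} [X _ conX|C tC IH].
    rewrite /f; case: pselect => // h.
    by case: (svalP (cid h)).
  have totC X Y : C X -> C Y -> incl X Y \/ incl Y X.
    by move=> /tC tX /tC tY; exact: tower_total incl_f _ _ tX tY.
  by move=> /(derives_chain totC) [//|[X /IH]].
have [/tower_con] := tower_top f.
set X := union _ => nXa fX.
have Xmax b : ~ X b -> derives (fun x => G x \/ X x \/ x = b) a.
  move=> nXb; apply: contrapT => nda.
  have h : exists b, adds X b by exists b.
  move: fX; rewrite /f; case: pselect => // h' /(_ (sval (cid h')) (or_intror erefl)).
  by have [] := svalP (cid h').
pose D b := derives (fun x => G x \/ X x) b.
have D_max b : ~ D b -> D (b → a).
  move=> nDb; apply/deduction.
  have /Xmax dXb : ~ X b by move=> Xb; apply: nDb; apply: Der_hyp; right.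
  by apply: derives_weaken dXb _ => x [|[|]]; tauto.
(* If both disjuncts were missing, each would imply [a] by maximality, and A8 would derive [a]. *)
have D_prime b c : D (b ∨ c) -> D b \/ D c.
  move=> Dbc; apply: contrapT => /not_orP [/D_max Dba /D_max Dca].
  apply: nXa; apply: Der_MP Dbc _; apply: Der_MP Dca _.
  exact: Der_MP Dba (Der_ax _ (A8 _ _ _)).
have D_mp b c : D b -> D (b → c) -> D c := @Der_MP _ _ _ _ _.
exists (@Theory D (@thm_derives _) D_mp D_prime (ex_intro (fun b => ~ D b) a nXa)) => //.
by move=> b Gb; apply: Der_hyp; left.
Qed.

(** * Truth values in a prime theory *)

Lemma mem_ax D a : axiom a -> D a.
Proof. by move=> ax; apply/mem_thm/Der_ax. Qed.

Lemma mem_mp_ax D a b : axiom (a → b) -> D a -> D b.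
Proof. by move=> /(mem_ax D) Dab Da; exact: mem_mp Da Dab. Qed.

Lemma mem_and D a b : D (a ∧ b) <-> D a /\ D b.
Proof.
split=> [Dab|[Da Db]].
  by split; [exact: mem_mp_ax (A4 _ _) Dab|exact: mem_mp_ax (A5 _ _) Dab].
exact: mem_mp Db (mem_mp_ax (A3 _ _) Da).
Qed.

Lemma mem_iff_ax D a b : axiom (a ↔ b) -> D a <-> D b.
Proof.
by move=> /(mem_ax D) /mem_and [Dab Dba]; split=> H; apply: mem_mp H _.
Qed.

Lemma mem_neg_and D a b : D (¬ (a ∧ b)) <-> D (¬ a) \/ D (¬ b).
Proof.
rewrite (mem_iff_ax D (A15 a b)); split; first exact: mem_prime.
by case; apply: mem_mp_ax; [exact: A6|exact: A7].
Qed.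

Lemma mem_excluded_middle D a : D a \/ D (¬ a).
Proof. exact/mem_prime/mem_ax/A10. Qed.

Lemma mem_circ_consistent D a : D (○ a) -> D a -> D (¬ a) -> False.
Proof.
have [b nDb] := mem_proper D => Dca Da Dna; apply: nDb.
exact: mem_mp Dna (mem_mp Da (mem_mp_ax (A11 _ _) Dca)).
Qed.

Lemma mem_bul D a : D (● a) <-> D a /\ D (¬ a).
Proof.
split=> [/(mem_mp_ax (A12 a)) /mem_and //|[Da Dna]].
by case: (mem_excluded_middle D (● a)) => // /mem_circ_consistent; case.
Qed.

Lemma mem_neg_bul D a : D (¬ ● a) <-> ~ (D a /\ D (¬ a)).
Proof.
split=> [Dca [Da Dna]|/mem_bul]; first exact: mem_circ_consistent Dca Da Dna.
by case: (mem_excluded_middle D (● a)).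
Qed.

(** In the [T0] case [¬ a] belongs to [D] by A10, so the three cases match the designation patterns
    of the three values. *)
Definition val D a : tv :=
  if `[< D a >] then if `[< D (¬ a) >] then Thalf else T1 else T0.

Lemma designated_val D a : designated (val D a) <-> D a.
Proof.
by rewrite /val; case: asboolP => // Da; case: asboolP.
Qed.

Lemma designated_tneg_val D a : designated (tneg (val D a)) <-> D (¬ a).
Proof.
rewrite /val; case: asboolP => [Da|nDa]; first by case: asboolP.
by split=> // _; case: (mem_excluded_middle D a).
Qed.

Lemma val_neg D a : val D (¬ a) = tneg (val D a).
Proof.
apply: tv_ext; first by rewrite designated_val designated_tneg_val.
have -> : tneg (tneg (val D a)) = val D a by case: val.
by rewrite designated_tneg_val designated_val; exact/mem_iff_ax/A13.
Qed.

Lemma val_bul D a : val D (● a) = tbul (val D a).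
Proof.
apply: tv_ext.
  rewrite designated_val mem_bul -designated_val -designated_tneg_val.
  by case: val => /=; intuition.
rewrite designated_tneg_val mem_neg_bul -designated_val -designated_tneg_val.
by case: val => /=; split=> [H|_ []] //; case: H.
Qed.

Lemma val_and D a b : val D (a ∧ b) = tmin (val D a) (val D b).
Proof.
apply: tv_ext.
  rewrite designated_tmin designated_val mem_and -!designated_val.
  by split=> /andP.
rewrite designated_tneg_tmin designated_tneg_val mem_neg_and.
by rewrite -!designated_tneg_val; split=> /orP.
Qed.

Lemma val_imp D a b :
  val D (a → b) = if designated (val D a) then val D b else T1.
Proof.
rewrite /Imp /Or /Sneg /Circ !(val_neg, val_and, val_bul).
by case: (val D a); case: (val D b).
Qed.

Lemma mem_imp D a b : D (a → b) <-> (D a -> D b).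
Proof.
rewrite -!designated_val val_imp.
by case: (designated (val D a)); split=> //; auto.
Qed.

(** [Sneg] is the classical negation available inside the logic. *)
Lemma mem_sneg D a : D (Sneg a) <-> ~ D a.
Proof.
rewrite -!designated_val /Sneg /Circ !(val_neg, val_and, val_bul).
by case: (val D a); split=> //= H; case: H.
Qed.

Lemma mem_equ D a b : D (a ≡ b) <-> val D a = val D b.
Proof.
rewrite -designated_val /Equ /Iff !(val_imp, val_neg, val_and).
by case: (val D a); case: (val D b).
Qed.

(** From here on, theorems are obtained by computing in prime theories instead of writing
    derivations. *)
Lemma thm_mem a : (forall D, D a) -> thm a.
Proof. by move=> Da; apply: contrapT => /Lindenbaum [D _]; apply. Qed.

Lemma thm_equ a b : thm (a ≡ b) <-> forall D, val D a = val D b.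
Proof.
split=> [ab D|ab]; first by apply/mem_equ/mem_thm.
by apply: thm_mem => D; exact/mem_equ.
Qed.

(** * Congruence from the rule RE *)

(** Serves to show that a formula differs from its immediate subformula, so that [repl] passes the
    root. *)
Fixpoint depth a : nat :=
  match a with
  | Var _ => 0
  | Neg b | Bul b | K _ b | Upd _ _ _ b => (depth b).+1
  | And b c => (depth b + depth c).+1
  end.

Lemma repl_self t g : repl t g t = g.
Proof. by case: t => * /=; rewrite asboolT. Qed.

Lemma val_K_congr i a b :
  (forall D, val D a = val D b) -> forall D, val D (K i a) = val D (K i b).
Proof.
move=> /thm_equ /Der_RE -/(_ (fun _ => False) (K i a)) /=.
rewrite asboolF => [|/esym /(congr1 depth) /n_Sn //].
by rewrite repl_self => /thm_equ.
Qed.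

Lemma val_Upd_congr (F : aframe N) (pr : F -> fml P N) (e : F) a b :
  (forall D, val D a = val D b) ->
  forall D, val D (Upd pr e a) = val D (Upd pr e b).
Proof.
move=> /thm_equ /Der_RE -/(_ (fun _ => False) (Upd pr e a)) /=.
rewrite asboolF => [|/esym /(congr1 depth) /n_Sn //].
by rewrite repl_self => /thm_equ.
Qed.

(** * Knowledge and the canonical model *)

Lemma mem_K_mp D i a b : thm (a → b) -> D (K i a) -> D (K i b).
Proof.
move=> /(Der_Nec (fun _ => False) i) /(mem_thm D) Kab Ka.
exact: mem_mp Ka (mem_mp_ax (AxK _ _ _) Kab).
Qed.

Lemma mem_Kh_mp D i a b : D (K i (a → b)) -> D (Kh i a) -> D (Kh i b).
Proof. by move=> Kab Ka; exact: mem_mp Ka (mem_mp_ax (AxK1 _ _ _) Kab). Qed.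

(** [Kh] is defined with the paraconsistent negation, yet it is also dual to [K] for classical
    negation; this lets the usual canonical arguments run. *)
Lemma mem_Kh D i a : D (Kh i a) <-> ~ D (K i (Sneg a)).
Proof.
split=> [Kha Ksa|nKsa].
  (* [K̂ ⊥] is refuted by [K̂ ⊥ → K̂ K ⊥ → K ⊥ → ⊥], with 5' and T. *)
  pose bot := a ∧ Sneg a.
  have nbot E : ~ E bot by move=> /mem_and [Ea /mem_sneg].
  have Khbot : D (Kh i bot).
    apply: mem_Kh_mp Kha; apply: mem_K_mp Ksa; apply: thm_mem => E.
    by rewrite !mem_imp mem_sneg.
  have KbKb : D (K i (bot → K i bot)).
    by apply/mem_thm/Der_Nec/thm_mem => E; rewrite mem_imp => /nbot.
  apply: (nbot D); apply: (mem_mp_ax (AxT i _)).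
  exact: mem_mp_ax (Ax5' _ _) (mem_Kh_mp KbKb Khbot).
apply: contrapT => nKha; apply: nKsa.
(* With [Kh i a] absent, [Kh i a → K i (Sneg a)] holds vacuously and K3 applies. *)
have: D (K i (a → Sneg a)).
  by apply: mem_mp_ax (AxK3 _ _ _) _; rewrite mem_imp => /nKha.
apply: mem_K_mp; apply: thm_mem => E; rewrite !mem_imp !mem_sneg; tauto.
Qed.

Definition crel i D E : Prop := forall a, D (K i a) -> E a.

Lemma crel_equiv i : RelationClasses.Equivalence (crel i).
Proof.
split.
- by move=> D a; exact/mem_mp_ax/AxT.
(* Symmetry: if [D] lacks [a], it lacks [K i a] by T, so by 5' and duality it knows [Sneg (K i a)],
   which then holds in [E]. *)
- move=> D E DE a EKa; apply: contrapT => nDa.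
  have nDKa : ~ D (K i a) by move=> /(mem_mp_ax (AxT _ _)).
  have /mem_sneg : E (Sneg (K i a)); last exact.
  apply: DE; apply: contrapT => /mem_Kh /(mem_mp_ax (Ax5' _ _)); exact: nDKa.
- by move=> D E H DE EH a /(mem_mp_ax (Ax4 _ _)) /DE /EH.
Qed.

Definition cmodel : kmodel P N :=
  KModel crel_equiv (fun D p => val D (Var p)).

Lemma mem_K D i a : D (K i a) <-> forall E, crel i D E -> E a.
Proof.
split=> [DKa E|]; first exact.
apply: contraPP => nDKa.
(* A derivation of [a] from the formulas known in [D] could be prefixed with [K i] line by line,
   giving [K i a] in [D]. *)
suff /Lindenbaum [E DE nEa] : ~ derives (fun b => D (K i b)) a.
  by move=> /(_ E DE).
move=> da; apply: nDKa.
set G := (fun b => _) in da.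
have GD b : G b -> D (K i b) by [].
elim: da GD => {a}{}G.
- by move=> a Ga; exact.
- by move=> a ax _; apply/mem_thm/Der_Nec/Der_ax.
- move=> a b _ IHa _ IHab GD; apply: mem_mp (IHa GD) _.
  exact: mem_mp_ax (AxK _ _ _) (IHab GD).
- by move=> j a da _ _; apply/mem_thm/Der_Nec/Der_Nec.
- by move=> t g a tg _ _; apply/mem_thm/Der_Nec/Der_RE.
Qed.

Lemma mem_neg_K D i a : D (¬ K i a) <-> exists2 E : theory, crel i D E & E (¬ a).
Proof.
(* Double negation under [K] turns the formula into a [Kh], to which the duality applies. *)
have val_Kh : val D (¬ K i a) = val D (Kh i (¬ a)).
  rewrite !val_neg; congr tneg; apply: val_K_congr => E.
  by rewrite !val_neg; case: val.
rewrite -designated_val val_Kh designated_val mem_Kh mem_K.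
split=> [/existsNP [E /not_implyP [DE]]|[E DE Ena] /(_ E DE) /mem_sneg //].
by rewrite mem_sneg => /contrapT; exists E.
Qed.

Lemma val_K D i a :
  val D (K i a) = tinf [set v | exists2 E, crel i D E & val E a = v]%classic.
Proof.
apply: tv_ext.
  rewrite designated_val designated_tinf mem_K; split=> [Da _ [E /Da Ea <-]|Da E DE].
    exact/designated_val.
  by apply/designated_val/Da; exists E.
rewrite designated_tneg_val designated_tneg_tinf mem_neg_K; split.
  by move=> [E DE /designated_tneg_val]; exists (val E a) => //; exists E.
by move=> [_ [E DE <-] /designated_tneg_val]; exists E.
Qed.

(** * The truth lemma without updates *)

Fixpoint static a : Prop :=
  match a with
  | Var _ => True
  | Neg b | Bul b | K _ b => static b
  | And b c => static b /\ static c
  | Upd _ _ _ _ => False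
  end.

Lemma truth_static a D : static a -> @eval P N a cmodel D = val D a.
Proof.
elim: a D => //= [a IH|a IH|a IHa b IHb|i a IH] D.
- by move=> sa; rewrite val_neg IH.
- by move=> sa; rewrite val_bul IH.
- by move=> [sa sb]; rewrite val_and IHa // IHb.
- move=> sa; rewrite val_K; congr tinf; apply/seteqP.
  by split=> v [E DE <-]; exists E; rewrite // IH.
Qed.

(** * Reduction to update-free formulas *)

(** Both halves are needed to transfer the truth lemma: one moves [val], the other [eval]. *)
Definition sim a b : Prop :=
  (forall D, val D a = val D b) /\
  forall (M : kmodel P N) (s : M), eval a s = eval b s.

Lemma sim_trans a b c : sim a b -> sim b c -> sim a c.
Proof.
by move=> [ab1 ab2] [bc1 bc2]; split=> *; rewrite ?ab1 ?bc1 ?ab2 ?bc2.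
Qed.

Lemma sim_neg a b : sim a b -> sim (¬ a) (¬ b).
Proof. by move=> [vab eab]; split=> *; rewrite ?val_neg ?vab //= eab. Qed.

Lemma sim_bul a b : sim a b -> sim (● a) (● b).
Proof. by move=> [vab eab]; split=> *; rewrite ?val_bul ?vab //= eab. Qed.

Lemma sim_and a b c d : sim a b -> sim c d -> sim (a ∧ c) (b ∧ d).
Proof.
move=> [vab eab] [vcd ecd].
by split=> *; rewrite ?val_and ?vab ?vcd //= eab ecd.
Qed.

Lemma sim_K i a b : sim a b -> sim (K i a) (K i b).
Proof.
move=> [vab eab]; split=> [|M s /=]; first exact: val_K_congr.
by congr tinf; apply/seteqP; split=> v [t st <-]; exists t; rewrite // eab.
Qed.

Lemma sim_Upd (F : aframe N) (pr : F -> fml P N) (e : F) a b :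
  sim a b -> sim (Upd pr e a) (Upd pr e b).
Proof.
move=> [vab eab]; split=> [|M s /=]; first exact: val_Upd_congr.
by case: decP.
Qed.

Lemma eval_imp a b (M : kmodel P N) (s : M) :
  eval (a → b) s = if designated (eval a s) then eval b s else T1.
Proof. by rewrite /=; case: (eval a s); case: (eval b s). Qed.

Lemma sim_axiom a b :
  axiom (a ≡ b) -> (forall (M : kmodel P N) (s : M), eval a s = eval b s) ->
  sim a b.
Proof. by move=> /mem_ax ab eab; split=> // D; exact/mem_equ. Qed.

Section Reduction.
Variables (U : amodel P N).
Implicit Types e f : U.

Lemma sim_upd_Var e (p : P) : sim (⟦U, e⟧ (Var p)) (pre e → Var p).
Proof.
apply: sim_axiom (AM1 _ _) _ => M s; rewrite eval_imp.
by case: ifPn => h; [rewrite eval_updT|rewrite eval_updF].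
Qed.

Lemma sim_upd_neg e a : sim (⟦U, e⟧ (¬ a)) (pre e → ¬ ⟦U, e⟧ a).
Proof.
apply: sim_axiom (AM2 _ _) _ => M s; rewrite eval_imp.
case: ifPn => h; last by rewrite eval_updF.
by rewrite eval_updT -[RHS]/(tneg (eval (⟦U, e⟧ a) s)) eval_updT.
Qed.

Lemma sim_upd_bul e a : sim (⟦U, e⟧ (● a)) (pre e → ● ⟦U, e⟧ a).
Proof.
apply: sim_axiom (AM3 _ _) _ => M s; rewrite eval_imp.
case: ifPn => h; last by rewrite eval_updF.
by rewrite eval_updT -[RHS]/(tbul (eval (⟦U, e⟧ a) s)) eval_updT.
Qed.

Lemma sim_upd_and e a b : sim (⟦U, e⟧ (a ∧ b)) (⟦U, e⟧ a ∧ ⟦U, e⟧ b).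
Proof.
apply: sim_axiom (AM4 _ _ _) _ => M s.
have -> : eval (⟦U, e⟧ a ∧ ⟦U, e⟧ b) s =
          tmin (eval (⟦U, e⟧ a) s) (eval (⟦U, e⟧ b) s) by [].
have [h|h] := boolP (designated (eval (pre e) s)); first by rewrite !eval_updT.
by rewrite !eval_updF.
Qed.

Lemma arel_refl i e : e \in enum (arel i e).
Proof. by rewrite mem_enum; have [] := arel_equiv i e e e. Qed.

Lemma designated_eval_conjs (T : eqType) (F : T -> fml P N) d (r : seq T)
    (M : kmodel P N) (s : M) : r != [::] ->
  designated (eval (conjs d (map F r)) s) =
  all (fun x => designated (eval (F x) s)) r.
Proof.
case: r => //= x r _; elim: r (F x) => /= [|y r IH] a; first by rewrite andbT.
by rewrite IH /= designated_tmin andbA.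
Qed.

Lemma designated_tneg_eval_conjs (T : eqType) (F : T -> fml P N) d (r : seq T)
    (M : kmodel P N) (s : M) : r != [::] ->
  designated (tneg (eval (conjs d (map F r)) s)) =
  has (fun x => designated (tneg (eval (F x) s))) r.
Proof.
case: r => //= x r _; elim: r (F x) => /= [|y r IH] a; first by rewrite orbF.
by rewrite IH /= designated_tneg_tmin orbA.
Qed.

Lemma designated_eval_K i a (M : kmodel P N) (s : M) :
  designated (eval (K i a) s) <-> forall t : M, krel i s t -> designated (eval a t).
Proof.
rewrite designated_tinf; split=> [da t st|da _ [t st <-]]; last exact: da.
by apply: da; exists t.
Qed.

Lemma designated_tneg_eval_K i a (M : kmodel P N) (s : M) :
  designated (tneg (eval (K i a) s)) <->
  exists2 t : M, krel i s t & designated (tneg (eval a t)).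
Proof.
rewrite designated_tneg_tinf; split=> [[_ [t st <-] da]|[t st da]].
  by exists t.
by exists (eval a t) => //; exists t.
Qed.

(** Both sides are infima over the pairs [(t, f)] related to [(s, e)]; pairs outside the updated
    model contribute only the value 1 on the right. *)
Lemma sim_upd_K e i a : sim (⟦U, e⟧ (K i a)) (pre e → conj_related i e a).
Proof.
apply: sim_axiom (AM5 _ _ _) _ => M s; rewrite eval_imp.
case: ifPn => h; last by rewrite eval_updF.
have nil_r : enum (arel i e) != [::] by have := arel_refl i e; case: (enum _).
rewrite eval_updT; apply: tv_ext.
  rewrite designated_eval_conjs // designated_eval_K; split.
    move=> da; apply/allP => f; rewrite mem_enum => ef.
    apply/designated_eval_K => t st.
    have [ht|ht] := boolP (designated (eval (pre f) t)); last by rewrite eval_updF.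
    by rewrite eval_updT; exact: da.
  move=> /allP da [[t f] ht] [/= st ef].
  have /da /designated_eval_K /(_ _ st) : f \in enum (arel i e) by rewrite mem_enum.
  by rewrite eval_updT.
rewrite designated_tneg_eval_conjs // designated_tneg_eval_K; split.
  move=> [[[t f] ht] [st ef] da]; apply/hasP; exists f.
    by rewrite mem_enum.
  by apply/designated_tneg_eval_K; exists t; rewrite // (eval_updT _ ht).
move=> /hasP [f]; rewrite mem_enum => ef /designated_tneg_eval_K [t st].
(* Outside the updated model the update has value 1, whose negation is not designated; so the
   witness lies inside. *)
have [ht|ht] := boolP (designated (eval (pre f) t)); last by rewrite eval_updF.
by rewrite eval_updT; exists (exist _ (t, f) ht).
Qed.

Definition reducible a : Prop := exists2 b, static b & sim a b.

Lemma reducible_sim a b : sim a b -> reducible b -> reducible a.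
Proof. by move=> ab [c sc bc]; exists c; last exact: sim_trans bc. Qed.

Lemma reducible_neg a : reducible a -> reducible (¬ a).
Proof. by move=> [b sb ab]; exists (¬ b); last exact: sim_neg. Qed.

Lemma reducible_bul a : reducible a -> reducible (● a).
Proof. by move=> [b sb ab]; exists (● b); last exact: sim_bul. Qed.

Lemma reducible_and a b : reducible a -> reducible b -> reducible (a ∧ b).
Proof.
by move=> [c sc ac] [d sd bd]; exists (c ∧ d); last exact: sim_and.
Qed.

Lemma reducible_K i a : reducible a -> reducible (K i a).
Proof. by move=> [b sb ab]; exists (K i b); last exact: sim_K. Qed.

Lemma reducible_imp a b : reducible a -> reducible b -> reducible (a → b).
Proof.
by move=> ra rb; repeat (done ||
  (first [apply: reducible_neg | apply: reducible_and | apply: reducible_bul])).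
Qed.

Lemma reducible_conjs (T : Type) (F : T -> fml P N) d (r : seq T) :
  reducible d -> (forall x, reducible (F x)) -> reducible (conjs d (map F r)).
Proof.
case: r => //= x r _ rF; elim: r (F x) (rF x) => //= y r IH a ra.
by apply: IH; apply: reducible_and.
Qed.

Lemma reducible_upd e a :
  (forall f, reducible (pre f)) -> static a -> reducible (⟦U, e⟧ a).
Proof.
(* The action stays general because the [K] case passes from [e] to the related actions. *)
move=> rpre; elim: a e => //= [p|a IH|a IH|a IHa b IHb|i a IH] e.
- move=> _; apply: reducible_sim (sim_upd_Var e p) _.
  by apply: reducible_imp => //; exists (Var p).
- move=> sa; apply: reducible_sim (sim_upd_neg e a) _.
  by apply: reducible_imp => //; apply/reducible_neg/IH.
- move=> sa; apply: reducible_sim (sim_upd_bul e a) _.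
  by apply: reducible_imp => //; apply/reducible_bul/IH.
- move=> [sa sb]; apply: reducible_sim (sim_upd_and e a b) _.
  by apply: reducible_and; [exact: IHa|exact: IHb].
- move=> sa; apply: reducible_sim (sim_upd_K e i a) _.
  (* The dummy of the conjunction is [a], static by assumption. *)
  apply: reducible_imp => //; apply: reducible_conjs; first by exists a.
  by move=> f; apply/reducible_K/IH.
Qed.

End Reduction.

(** Updates are removed from the inside out: the body becomes static first. Preconditions, exposed
    by the reduction axioms, are covered by their own induction hypotheses. *)
Lemma all_reducible a : reducible a.
Proof.
elim: a => [p|a|a|a ? b ?|i a|F pr IHpr e a [b sb ab]].
- by exists (Var p).
- exact: reducible_neg.
- exact: reducible_bul.
- exact: reducible_and.
- exact: reducible_K.
- apply: reducible_sim (sim_Upd pr e ab) _.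
  exact: (@reducible_upd (AModel pr)).
Qed.

(** * The full truth lemma and strong completeness *)

Lemma truth a D : @eval P N a cmodel D = val D a.
Proof.
by have [b sb [vab eab]] := all_reducible a; rewrite eab truth_static.
Qed.

End Completeness.

Theorem theorem44 (P : countType) (N : finType) (G : fml P N -> Prop)
    (a : fml P N) :
  entails G a -> derives G a.
Proof.
(* The countermodel is the canonical model at a prime theory that contains [G] and omits [a]. *)
move=> Ga; apply: contrapT => /Lindenbaum [D GD nDa]; apply: nDa.
apply/designated_val; rewrite -truth; apply: (Ga (cmodel : kmodel P N)) => g Gg.
by rewrite truth; apply/designated_val/GD.
Qed.
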